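(* Let $n\ge 1$ and $0\le d\le \lfloor (n-1)/2\rfloor$. The number of ballot permutations of length $n$ with exactly $d$ descents equals the number of odd order permutations $\pi$ of length $n$ with $M(\pi)=d$.
   Context: For a permutation $\pi=\pi_1\pi_2\cdots\pi_n$ of $[n]=\{1,\dots,n\}$, a position $1\le i\le n-1$ is a descent if $\pi_i>\pi_{i+1}$ and an ascent if $\pi_i<\pi_{i+1}$; $\operatorname{des}(\pi)$ and $\operatorname{asc}(\pi)$ denote their numbers. A ballot permutation is a permutation $\pi$ such that $\operatorname{asc}(\pi_1\cdots\pi_i)\ge \operatorname{des}(\pi_1\cdots\pi_i)$ for every $i\in[n]$. An odd order permutation of $[n]$ is one all of whose cycles (in its disjoint cycle decomposition) have odd length. For a cycle $c=(c_1c_2\cdots c_k)$, let $\operatorname{cdes}(c)=|\{i\in[k]: c_i>c_{i+1}\}|$ and $\operatorname{casc}(c)=|\{i\in[k]: c_i<c_{i+1}\}|$, where $c_{k+1}=c_1$. For a permutation $\pi$, $M(\pi)=\sum_c \min(\operatorname{cdes}(c),\operatorname{casc}(c))$, the sum over all cycles $c$ of $\pi$. *)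

(* Defs.v *)
From mathcomp Require Import all_boot all_order all_fingroup.
Set Implicit Arguments. Unset Strict Implicit. Unset Printing Implicit Defensive.

(* Permutations of [n] are modelled as {perm 'I_n}; the value i : 'I_n stands
   for i+1 in [n] (an order-preserving relabelling, so descents/ascents agree). *)

Definition oneline n (p : {perm 'I_n}) : seq nat := [seq val (p i) | i <- enum 'I_n].

Definition sdes (w : seq nat) : nat := count (fun xy => xy.2 < xy.1) (zip w (behead w)).
Definition sasc (w : seq nat) : nat := count (fun xy => xy.1 < xy.2) (zip w (behead w)).

Definition des n (p : {perm 'I_n}) := sdes (oneline p).

Definition ballot n (p : {perm 'I_n}) : bool :=
  [forall i : 'I_n, sdes (take i.+1 (oneline p)) <= sasc (take i.+1 (oneline p))].

Definition cdes (c : seq nat) : nat := count (fun xy => xy.2 < xy.1) (zip c (rot 1 c)).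
Definition casc (c : seq nat) : nat := count (fun xy => xy.1 < xy.2) (zip c (rot 1 c)).

Definition cycle_seq n (p : {perm 'I_n}) (A : {set 'I_n}) : seq nat :=
  if [pick x in A] is Some x then [seq val y | y <- traject p x #|A|] else [::].

Definition odd_order n (p : {perm 'I_n}) : bool :=
  [forall A in porbits p, odd #|A|].

Definition Mstat n (p : {perm 'I_n}) : nat :=
  \sum_(A in porbits p) minn (cdes (cycle_seq p A)) (casc (cycle_seq p A)).

(* Main.v *)
Require Import Defs.
From mathcomp Require Import all_boot all_order all_fingroup all_algebra.
From mathcomp Require Import zify.
From Stdlib Require Import Setoid Ring.

(** Let [P] be the exponential generating function of nonempty permutations by
    descents, with [t] marking descents. Removing the largest letter gives
    [P' = (1 + P)(1 + t P)], from which [Q = 1 + (1 + t) P] satisfies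
    [Q(x) Q(-x) = 1] and [Q' = Q (1 + t + t (P(x) + P(-x)))].
    Cutting a word at a minimum of the height [asc - des] of its prefixes writes
    it as a reversed ballot word followed by a ballot word, whence [Q = F G]: the
    series [F] counts ballot words by [des] and [G] counts them by [asc + 1].
    In degree [n] the exponents of [t] are less than [n / 2] in [F] and greater
    than [n / 2] in [G], so this is a Wiener-Hopf factorization, and the
    logarithmic derivative of [F] is the low degree part of that of [Q]. That part
    counts the odd cycles through the largest letter, with weight
    [t ^ min(cdes, casc)], hence [F] also counts odd order permutations by [M]. *)

Set Implicit Arguments. Unset Strict Implicit. Unset Printing Implicit Defensive.
Import Order.TTheory GRing.Theory Num.Theory.

(** * Exponential generating functions *)

Section Conv.
Variable K : comNzRingType.
Local Open Scope ring_scope.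
Implicit Types (f g h : nat -> K) (n : nat).

Definition dseq f : nat -> K := fun n => f n.+1.

(* The binomial convolution [\sum_k 'C(n, k) f k * g (n - k)], defined through the
   Leibniz rule. *)
Fixpoint conv f g n : K :=
  if n is n'.+1 then conv (dseq f) g n' + conv f (dseq g) n' else f 0%N * g 0%N.

Definition cseq (c : K) : nat -> K := fun n => if n is 0 then c else 0.
Definition addseq f g : nat -> K := fun n => f n + g n.
Definition oppseq f : nat -> K := fun n => - f n.
Definition diffseq f g : nat -> K := fun n => f n - g n.

Lemma eq_conv f f' g g' : f =1 f' -> g =1 g' -> conv f g =1 conv f' g'.
Proof.
move=> ef eg n; elim: n f f' g g' ef eg => [|n IH] f f' g g' ef eg /=.
  by rewrite ef eg.
by congr (_ + _); apply: IH => // k; rewrite /dseq ?ef ?eg.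
Qed.

Lemma convC f g : conv f g =1 conv g f.
Proof.
move=> n; elim: n f g => [|n IH] f g /=; first by rewrite mulrC.
by rewrite addrC IH [conv (dseq f) g n]IH.
Qed.

Lemma convDl f f' g : conv (addseq f f') g =1 addseq (conv f g) (conv f' g).
Proof.
move=> n; elim: n f f' g => [|n IH] f f' g; first by rewrite /addseq /= mulrDl.
rewrite /= (IH (dseq f) (dseq f') g) (IH f f' (dseq g)) /addseq /=.
by rewrite addrACA.
Qed.

Lemma convDr f g g' : conv f (addseq g g') =1 addseq (conv f g) (conv f g').
Proof. by move=> n; rewrite convC convDl /addseq !(convC f). Qed.

Lemma conv_eq0 f g n : (forall k, (k <= n)%N -> g k = 0) -> conv f g n = 0.
Proof.
elim: n f g => [|n IH] f g g0 /=; first by rewrite g0 ?mulr0.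
rewrite IH => [|k le_kn]; last by rewrite g0 // leqW.
by rewrite IH ?addr0 // => k le_kn; rewrite /dseq g0.
Qed.

Lemma convS f g n : conv f g n.+1 = conv (dseq f) g n + conv f (dseq g) n.
Proof. by []. Qed.

Lemma dseq_conv f g : dseq (conv f g) =1 addseq (conv (dseq f) g) (conv f (dseq g)).
Proof. by []. Qed.

Lemma conv_lead f g n :
  (forall k, (k < n)%N -> f k = 0) -> conv f g n = f n * g 0%N.
Proof.
elim: n f g => [//|n IH] f g f0; rewrite /= IH => [|k lt_kn]; last exact: f0.
by rewrite [X in _ + X]convC conv_eq0 ?addr0 // => k le_kn; apply: f0.
Qed.

Lemma convA f g h : conv f (conv g h) =1 conv (conv f g) h.
Proof.
move=> n; elim: n f g h => [|n IH] f g h; first by rewrite /= mulrA.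
rewrite !convS (eq_conv (dseq_conv f g) (frefl h)) convDl.
rewrite (eq_conv (frefl f) (dseq_conv g h)) convDr.
by rewrite /addseq !IH addrA.
Qed.

Lemma conv1 f : conv (cseq 1) f =1 f.
Proof.
move=> n; elim: n f => [|n IH] f /=; first by rewrite mul1r.
by rewrite IH convC conv_eq0 ?add0r.
Qed.

(** The predicates are graded by the degree and generalized in the induction, because [dseq] shifts
    the grading of the factor that it differentiates. *)
Lemma conv_closed (A B C : nat -> K -> Prop) f g n :
    (forall k x y, C k x -> C k y -> C k (x + y)) ->
    (forall i j x y, A i x -> B j y -> C (i + j)%N (x * y)) ->
    (forall k, A k (f k)) -> (forall k, B k (g k)) -> C n (conv f g n).
Proof.
move=> CD CM; elim: n f g A B C CD CM => [|n IH] f g A B C CD CM Af Bg.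
  exact: (CM 0%N 0%N).
rewrite convS; apply: (CD).
  by apply: (IH _ _ (A \o succn) B (C \o succn)) => //= [k|i]; [apply: CD|apply: (CM i.+1)].
apply: (IH _ _ A (B \o succn) (C \o succn)) => //= [k|i j]; first exact: CD.
by rewrite -addnS; apply: CM.
Qed.

(** This lets [ring] prove identities between series, with pointwise equality as the setoid. *)
Lemma seq_ring_theory :
  ring_theory (cseq 0) (cseq 1) addseq conv diffseq oppseq (@eqfun K nat).
Proof.
split=> [f n|f g n|f g h n|f|f g|f g h|f g h|f g n|f n] //.
- by rewrite /addseq /cseq; case: n => *; rewrite add0r.
- exact: addrC.
- exact: addrA.
- exact: conv1.
- exact: convC.
- exact: convA.
- exact: convDl.
- by rewrite /addseq subrr /cseq; case: n.
Qed.

Lemma seq_eq_equiv : Equivalence (@eqfun K nat).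
Proof. by split=> [f|f g e n|f g h e1 e2 n]; rewrite // e1. Qed.

Lemma seq_eq_ext : ring_eq_ext (@addseq) conv (@oppseq) (@eqfun K nat).
Proof.
split=> [f f' ef g g' eg n|f f' ef g g' eg|f f' ef n].
- by rewrite /addseq ef eg.
- exact: eq_conv.
- by rewrite /oppseq ef.
Qed.

Add Ring seq_ring : seq_ring_theory (setoid seq_eq_equiv seq_eq_ext).

Local Infix "*" := conv.
Local Infix "+" := addseq.
Local Infix "-" := diffseq.

Lemma eq_addseq f f' g g' : f =1 f' -> g =1 g' -> f + g =1 f' + g'.
Proof. by move=> ef eg n; rewrite /addseq ef eg. Qed.

Lemma dseq_cseq c f : dseq (cseq c * f) =1 cseq c * dseq f.
Proof. by move=> n; rewrite dseq_conv /addseq convC conv_eq0 ?add0r. Qed.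

Lemma conv_cseq c f n : (cseq c * f) n = (c * f n)%R.
Proof.
elim: n f => [|n IH] f //.
by rewrite -[LHS]/(dseq _ n) dseq_cseq IH.
Qed.

(** Coefficient [k.+1] of [f] is a convolution that involves [f] only up to [k], so strong induction
    applies. *)
Lemma linear_ode_eq0 f g : f 0%N = 0%R -> dseq f =1 g * f -> f =1 cseq 0.
Proof.
move=> f0 df n; suff {n}: forall m k, (k <= m)%N -> f k = 0%R.
  by move=> f_eq0; rewrite (f_eq0 n) // /cseq; case: n.
elim=> [|m IH] [|k] // le_km; rewrite -[LHS]/(dseq f k) df conv_eq0 // => j le_jk.
by rewrite IH // (leq_trans le_jk).
Qed.

Lemma linear_ode_unique f f' g :
  f 0%N = f' 0%N -> dseq f =1 g * f -> dseq f' =1 g * f' -> f =1 f'.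
Proof.
move=> f0 df df' n; apply/eqP; rewrite -subr_eq0; apply/eqP.
have d0 : f - f' =1 cseq 0.
  apply: (@linear_ode_eq0 _ g); first by rewrite /diffseq f0 subrr.
  have e : g * (f - f') =1 g * f - g * f' by ring.
  by move=> k; rewrite e /diffseq -df -df'.
by rewrite -[LHS]/((f - f') n) d0 /cseq; case: (n).
Qed.

(** The substitution of [-x] for [x] in an exponential generating function. *)
Definition altseq f : nat -> K := fun n => ((-1) ^+ n * f n)%R.

Lemma dseq_altseq f : dseq (altseq f) =1 oppseq (altseq (dseq f)).
Proof. by move=> n; rewrite /dseq /altseq /oppseq exprS mulN1r mulNr. Qed.

Lemma altseq_conv f g : altseq (f * g) =1 altseq f * altseq g.
Proof.
move=> n; elim: n f g => [|n IH] f g; first by rewrite /altseq /= !expr0 !mul1r.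
rewrite -[LHS]/(dseq _ n) dseq_altseq convS.
rewrite (eq_conv (dseq_altseq f) (frefl _)) (eq_conv (frefl _) (dseq_altseq g)).
have eN a b : oppseq a * b + a * oppseq b =1 oppseq (a * b + a * b) by ring.
have e a b c d : oppseq a * b + c * oppseq d =1 oppseq (a * b + c * d) by ring.
rewrite -[RHS]/((_ + _) n) e /oppseq /addseq -!IH.
by rewrite /altseq dseq_conv /addseq mulrDr.
Qed.

(** A product rule for the defect from a prescribed logarithmic derivative, [a] being the one
    intended for [f] and [b] the one for [g]. *)
Lemma dseq_conv_log f g a b :
  dseq (f * g) - f * g * (a + b) =1 (dseq f - f * a) * g + f * (dseq g - g * b).
Proof.
have e : (dseq f * g + f * dseq g) - f * g * (a + b) =1
    (dseq f - f * a) * g + f * (dseq g - g * b) by ring.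
exact: e.
Qed.

(** * The Eulerian differential equation *)

Section Eulerian.
Variables (t : K) (P : nat -> K).
Let T := cseq t.
Let S := cseq 1 + T.
Let one : nat -> K := cseq 1.
Hypothesis P0 : P 0%N = 0%R.
Hypothesis dP : dseq P =1 (one + P) * (one + T * P).

Lemma dseqS f : dseq (S * f) =1 S * dseq f.
Proof.
have eS : S =1 cseq (1 + t)%R.
  by move=> [|n]; rewrite /S /T /addseq /cseq ?addr0.
by move=> n; rewrite -(eq_conv (fsym eS) (frefl _)) -dseq_cseq; apply: (eq_conv eS).
Qed.

Lemma dseq_altP :
  dseq (altseq P) =1 oppseq ((one + altseq P) * (one + T * altseq P)).
Proof.
move=> n; rewrite dseq_altseq /oppseq /altseq dP -/(altseq _ n) altseq_conv.
congr (- _)%R; apply: eq_conv => k.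
  by rewrite /altseq /addseq mulrDr /one /cseq; case: k => *; rewrite ?mulr0 ?expr0 ?mulr1.
rewrite /altseq /addseq mulrDr !conv_cseq mulrCA; congr (_ + _)%R.
by rewrite /one /cseq; case: k => *; rewrite ?mulr0 ?expr0 ?mulr1.
Qed.

(* With [Q = 1 + (1 + t) P], this says [Q(x) Q(-x) = 1]. *)
Lemma eulerian_reflection : P + altseq P + S * (P * altseq P) =1 cseq 0.
Proof.
(* With [R] for [altseq P], the equations of [P] and [R] give the left side the derivative
   [T * (P - R)] times itself, and it vanishes at the origin. *)
apply: (@linear_ode_eq0 _ (T * (P - altseq P))).
  by rewrite /addseq /= /altseq P0 !(mulr0, mul0r, addr0).
set R := altseq P.
have e : dseq (P + R + S * (P * R)) =1
    dseq P + dseq R + S * (dseq P * R + P * dseq R).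
  by move=> n; exact: (eq_addseq (frefl (dseq P + dseq R)) (dseqS (P * R))).
move=> n; rewrite e.
have e1 := eq_addseq dP dseq_altP.
have e2 := eq_addseq (eq_conv dP (frefl R)) (eq_conv (frefl P) dseq_altP).
rewrite (eq_addseq e1 (eq_conv (frefl S) e2)) -/R; move: n.
rewrite -/(eqfun _ _) /S /one; ring.
Qed.

(** The right side exceeds [S * dseq P] by [T] times the expression that [eulerian_reflection]
    annihilates. *)
Lemma dseq_eulerian :
  let Q := one + S * P in dseq Q =1 Q * (S + T * (P + altseq P)).
Proof.
move=> Q; have dQ : dseq Q =1 S * ((one + P) * (one + T * P)).
  move=> n; rewrite -[LHS]/((dseq one + dseq (S * P)) n) /addseq dseqS.
  by rewrite add0r (eq_conv (frefl S) dP).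
have e : Q * (S + T * (P + altseq P)) =1
    S * ((one + P) * (one + T * P)) + T * (P + altseq P + S * (P * altseq P)).
  by rewrite /Q /S /one; ring.
move=> n; rewrite e.
rewrite (eq_addseq (frefl _) (eq_conv (frefl T) eulerian_reflection)).
rewrite -[RHS]/(GRing.add _ (conv T (cseq 0) n)) conv_cseq dQ.
by rewrite /cseq; case: n => *; rewrite mulr0 addr0.
Qed.

End Eulerian.
End Conv.

(** * Wiener-Hopf factorization by degree *)

Section WienerHopf.
Local Open Scope ring_scope.

(** Doubling the exponent expresses the bound [n / 2] on the exponents, from above here and from
    below in [poly_ge], without rounding. *)
Definition poly_le (p : {poly int}) n := forall b, (n < b.*2)%N -> p`_b = 0.
Definition poly_ge (p : {poly int}) n := forall b, (b.*2 < n)%N -> p`_b = 0.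

Lemma conv_poly_le f g n :
  (forall k, poly_le (f k) k) -> (forall k, poly_le (g k) k) ->
  poly_le (conv f g n) n.
Proof.
move=> lef leg; pose C k (p : {poly int}) := poly_le p k.
apply: (conv_closed (A := C) (B := C) (C := C)) => //.
  by move=> k p q lep leq b lt_b; rewrite coefD lep ?leq ?addr0.
move=> i j p q lep leq b lt_b; rewrite coefM big1 // => k _.
have [le_k|lt_k] := leqP k.*2 i; last by rewrite lep ?mul0r.
by rewrite [X in _ * X]leq ?mulr0 //; have := ltn_ord k; lia.
Qed.

Lemma conv_poly_ge a f g n :
  (forall k, poly_ge (f k) k) -> (forall k, poly_ge (g k) (k + a)) ->
  poly_ge (conv f g n) (n + a).
Proof.
move=> gef geg; pose A k (p : {poly int}) := poly_ge p k.
pose C k (p : {poly int}) := poly_ge p (k + a).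
apply: (conv_closed (A := A) (B := C) (C := C)) => //.
  by move=> k p q gep geq b lt_b; rewrite coefD gep ?geq ?addr0.
move=> i j p q gep geq b lt_b; rewrite coefM big1 // => k _.
have [le_k|lt_k] := leqP i k.*2; last by rewrite gep ?mul0r.
by rewrite [X in _ * X]geq ?mulr0 //; have := ltn_ord k; lia.
Qed.

(* Uniqueness in the Wiener-Hopf factorization: in [F' G + F G' = F G (A + B)]
   the terms carrying [F] live in low degree and those carrying [G] in high
   degree, so the two logarithmic derivatives can be read off separately. *)
Lemma wiener_hopf (f g a b : nat -> {poly int}) :
    f 0%N = 1 -> g 0%N = 1 ->
    (forall n, poly_le (f n.+1) n) -> (forall n, poly_ge (g n.+1) n.+2) ->
    (forall n, poly_le (a n) n) -> (forall n, poly_ge (b n) n.+2) ->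
    dseq (conv f g) =1 conv (conv f g) (addseq a b) ->
  dseq f =1 conv f a.
Proof.
move=> f0 g0 lef geg lea geb dfg n.
pose x := diffseq (dseq f) (conv f a); pose y := diffseq (dseq g) (conv g b).
have xy0 : addseq (conv x g) (conv f y) =1 cseq 0.
  by move=> k; rewrite -dseq_conv_log /diffseq dfg subrr /cseq; case: k.
have lex k : poly_le (x k) k.
  have le1 : poly_le (conv f a k) k.
    apply: conv_poly_le => // -[|j]; first by rewrite f0 => -[|i] //; rewrite coef1.
    by move=> i lt_i; apply: lef; lia.
  by move=> i lt_i; rewrite /x /diffseq /dseq coefB lef ?le1 ?subr0.
have gey k : poly_ge (y k) k.+2.
  have ge1 : poly_ge (conv g b k) k.+2.
    rewrite -addn2; apply: conv_poly_ge => [[|j]|j]; rewrite ?addn2 //.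
    by move=> i lt_i; apply: geg; lia.
  by move=> i lt_i; rewrite /y /diffseq /dseq coefB geg ?ge1 ?subr0.
(* Once [x] and [y] vanish below [m], coefficient [m] of [xy0] reads [x m + y m = 0]. The exponents
   are at most [m / 2] in [x m] and at least [m / 2 + 1] in [y m], so both vanish. *)
suff /(_ n.+1 n (leqnn _)) [x0 _] : forall m k, (k < m)%N -> x k = 0 /\ y k = 0.
  by apply/eqP; rewrite -subr_eq0; apply/eqP.
elim=> [//|m IH] k; rewrite ltnS leq_eqVlt => /orP[/eqP->|/IH//].
have : x m + y m = 0.
  have x0 j : (j < m)%N -> x j = 0 by move/IH=> [].
  have y0 j : (j < m)%N -> y j = 0 by move/IH=> [].
  have := xy0 m; rewrite /addseq conv_lead // convC conv_lead // f0 g0 !mulr1 => ->.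
  by rewrite /cseq; case: (m).
move=> xy; have xc i : (x m)`_i + (y m)`_i = 0 by rewrite -coefD xy coef0.
have x0 : x m = 0.
  apply/polyP => i; rewrite coef0; have := xc i.
  have [le_i|lt_i] := leqP i.*2 m; last by rewrite lex.
  by rewrite gey ?addr0 //; lia.
by split=> //; move: xy; rewrite x0 add0r.
Qed.

End WienerHopf.

(** * Words, insertions and cuts *)

Section Words.
Variable T : Type.
Implicit Types (x y : T) (s w : seq T).

Fixpoint insertions x w : seq (seq T) :=
  (x :: w) :: (if w is y :: w' then map (cons y) (insertions x w') else [::]).

(** Unfolding exposes the insertion of the head, which is the largest letter in [desc n]. *)
Fixpoint perms s : seq (seq T) :=
  if s is x :: s' then flatten (map (insertions x) (perms s')) else [:: [::]].

Fixpoint cuts w : seq (seq T * seq T) :=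
  ([::], w) :: (if w is y :: w' then [seq (y :: c.1, c.2) | c <- cuts w'] else [::]).

Fixpoint splits s : seq (seq T * seq T) :=
  if s is x :: s' then
    [seq (x :: c.1, c.2) | c <- splits s'] ++ [seq (c.1, x :: c.2) | c <- splits s']
  else [:: ([::], [::])].

Lemma insertions_cons x y w :
  insertions x (y :: w) = [:: x, y & w] :: map (cons y) (insertions x w).
Proof. by []. Qed.

Lemma cuts_cons y w : cuts (y :: w) = ([::], y :: w) :: [seq (y :: c.1, c.2) | c <- cuts w].
Proof. by []. Qed.

Arguments insertions : simpl never.
Arguments cuts : simpl never.

Section Sums.
Variable R : nmodType.
Local Open Scope ring_scope.

Lemma sum_insertions_nil x (f : seq T -> R) : \sum_(v <- insertions x [::]) f v = f [:: x].
Proof. exact: big_seq1. Qed.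

Lemma sum_cuts_nil (f : seq T * seq T -> R) : \sum_(c <- cuts [::]) f c = f ([::], [::]).
Proof. exact: big_seq1. Qed.

Lemma sum_insertions_cons x y w (f : seq T -> R) :
  \sum_(v <- insertions x (y :: w)) f v =
  f [:: x, y & w] + \sum_(v <- insertions x w) f (y :: v).
Proof. by rewrite insertions_cons big_cons big_map. Qed.

Lemma sum_cuts_cons y w (f : seq T * seq T -> R) :
  \sum_(c <- cuts (y :: w)) f c =
  f ([::], y :: w) + \sum_(c <- cuts w) f (y :: c.1, c.2).
Proof. by rewrite cuts_cons big_cons big_map. Qed.

Lemma sum_insertions x w (f : seq T -> R) :
  \sum_(v <- insertions x w) f v = \sum_(c <- cuts w) f (c.1 ++ x :: c.2).
Proof.
elim: w f => [|y w IH] f; first by rewrite !big_seq1.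
by rewrite sum_insertions_cons sum_cuts_cons IH.
Qed.

(** A cut of a word containing the new letter leaves it on one side; the same pair arises by cutting
    first and inserting the letter into that side. *)
Lemma sum_cuts_insertions x w (f : seq T -> seq T -> R) :
  \sum_(v <- insertions x w) \sum_(c <- cuts v) f c.1 c.2 =
  \sum_(c <- cuts w) (\sum_(a <- insertions x c.1) f a c.2 +
                      \sum_(b <- insertions x c.2) f c.1 b).
Proof.
elim: w f => [|y w IH] f.
  by rewrite sum_insertions_nil sum_cuts_cons !sum_cuts_nil /= !sum_insertions_nil addrC.
rewrite sum_insertions_cons !sum_cuts_cons /= sum_insertions_nil sum_insertions_cons.
under [X in _ + X = _]eq_bigr do rewrite sum_cuts_cons.
rewrite big_split /= (IH (fun a b => f (y :: a) b)).
under [X in _ = _ + X]eq_bigr do rewrite sum_insertions_cons.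
rewrite !big_split /=.
by rewrite [LHS](AC ((1*2)*(1*2)) ((2*(1*4))*((3*5)*6))).
Qed.

(** By induction on [s]: the two choices of a side for the head letter match the two sums in
    [sum_cuts_insertions]. *)
Lemma sum_splits s (f : seq T -> seq T -> R) :
  \sum_(c <- splits s) \sum_(a <- perms c.1) \sum_(b <- perms c.2) f a b =
  \sum_(w <- perms s) \sum_(c <- cuts w) f c.1 c.2.
Proof.
elim: s f => [|x s IH] f; first by rewrite !big_seq1.
rewrite /= big_cat !big_map /= big_flatten big_map.
under [RHS]eq_bigr do rewrite sum_cuts_insertions.
rewrite -(IH (fun a b => \sum_(a' <- insertions x a) f a' b +
                         \sum_(b' <- insertions x b) f a b')).
rewrite -big_split; apply: eq_bigr => c _ /=.
rewrite big_flatten big_map -big_split; apply: eq_bigr => a _ /=.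
rewrite big_split exchange_big /=; congr (_ + _).
by rewrite big_flatten big_map.
Qed.

Lemma sum_perms_cons x s (f : seq T -> R) :
  \sum_(w <- perms (x :: s)) f w =
  \sum_(c <- splits s) \sum_(a <- perms c.1) \sum_(b <- perms c.2) f (a ++ x :: b).
Proof.
rewrite (sum_splits s (fun a b => f (a ++ x :: b))) big_flatten big_map.
by apply: eq_bigr => w _; rewrite sum_insertions.
Qed.

End Sums.

Lemma size_insertions x w : size (insertions x w) = (size w).+1.
Proof. by elim: w => // y w IH; rewrite insertions_cons /= size_map IH. Qed.

Lemma cutsE w : cuts w = [seq (take i w, drop i w) | i <- iota 0 (size w).+1].
Proof.
elim: w => // y w IH; rewrite cuts_cons IH -map_comp [iota _ _]/= map_cons.
by congr cons; rewrite -[RHS]/(map _ (iota 1 (size w).+1)) (iotaDl 1 0 (size w).+1) -map_comp.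
Qed.

End Words.

Lemma perms_map (T U : Type) (g : T -> U) s :
  perms (map g s) = map (map g) (perms s).
Proof.
have ins x w : insertions (g x) (map g w) = map (map g) (insertions x w).
  by elim: w => // y w IH; rewrite map_cons [LHS]insertions_cons insertions_cons /= IH -!map_comp.
elim: s => //= x s ->; rewrite map_flatten -!map_comp; congr flatten.
by apply: eq_map => w; apply: ins.
Qed.

Section WordsEq.
Variable T : eqType.
Implicit Types (x y : T) (s w : seq T).

Lemma mem_insertions x w v :
  (v \in insertions x w) = has (fun c => v == c.1 ++ x :: c.2) (cuts w).
Proof.
elim: w v => [|y w IH] v; first by rewrite mem_seq1 /= orbF.
rewrite insertions_cons cuts_cons in_cons /=; congr (_ || _); rewrite has_map.
case: v => [|z v]; first by apply/mapP/hasP => [[] //|[c _] /=].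
have [->|neq] := eqVneq z y.
  rewrite mem_map; first by rewrite IH; apply: eq_has => c /=; rewrite eqseq_cons eqxx.
  by move=> a b [].
apply/mapP/hasP => [[u _ [e]]|[c _ /=]]; first by rewrite e eqxx in neq.
by rewrite eqseq_cons (negPf neq).
Qed.

Lemma mem_cuts w a b : (a, b) \in cuts w = (w == a ++ b).
Proof.
elim: w a => [|y w IH] [|x a]; rewrite ?cuts_cons ?mem_seq1 //=.
- by rewrite xpair_eqE eqxx eq_sym.
- by rewrite in_cons xpair_eqE eqxx /= eq_sym -[RHS]orbF; congr (_ || _); apply/mapP => -[[]].
- rewrite in_cons /= eqseq_cons; have [->|neq] := eqVneq y x.
    rewrite -[(x :: a, b)]/((fun c => (x :: c.1, c.2)) (a, b)).
    by rewrite mem_map ?IH // => -[? ?] [? ?] [-> ->].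
  by apply/mapP => -[[u v] _ [e]]; rewrite e eqxx in neq.
Qed.

Lemma mem_perms s w : (w \in perms s) = perm_eq w s.
Proof.
elim: s w => [|x s IH] w /=; first by rewrite mem_seq1; apply/eqP/perm_nilP.
apply/flattenP/idP => [[_ /mapP[v + ->]]|e].
  rewrite IH => e; rewrite mem_insertions => /hasP[[a b]].
  rewrite mem_cuts => /eqP ev /eqP->; rewrite -cat1s perm_catCA /= perm_cons.
  by rewrite -ev.
have xw : x \in w by rewrite (perm_mem e) mem_head.
case/splitPr: xw e => a b; rewrite -cat1s perm_catCA /= perm_cons => e.
exists (insertions x (a ++ b)); first by rewrite map_f // IH.
by rewrite mem_insertions; apply/hasP; exists (a, b); rewrite ?mem_cuts.
Qed.

Lemma size_perms s : size (perms s) = (size s)`!.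
Proof.
elim: s => //= x s IH; rewrite size_flatten /shape -map_comp sumnE big_map.
rewrite (eq_big_seq (fun=> (size s).+1)); last first.
  by move=> w; rewrite mem_perms => /perm_size /= <-; rewrite size_insertions.
by rewrite big_const_seq count_predT iter_addn_0 IH mulnC factS mulnC.
Qed.

Lemma perms_uniq s : uniq s -> uniq (perms s).
Proof.
move=> us; have := permutations_uniq s.
have := size_permutations us; rewrite -size_perms => es.
move/leq_size_uniq => -> //; last by rewrite es.
by move=> w; rewrite mem_permutations mem_perms.
Qed.

Lemma sum_perms_rev (R : nmodType) s (f : seq T -> R) :
  uniq s -> (\sum_(w <- perms s) f (rev w) = \sum_(w <- perms s) f w)%R.
Proof.
move=> us; rewrite -[LHS](big_map rev xpredT) ; apply: perm_big.
apply: uniq_perm => [||w]; rewrite ?map_inj_uniq ?perms_uniq //; try exact: (can_inj revK).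
by rewrite -{1}[w]revK mem_map ?mem_perms ?perm_rev //; exact: (can_inj revK).
Qed.

End WordsEq.

(** * Ascents and descents of words *)

Section Adjacent.
Variables (T : Type) (r : rel T).
Implicit Types (x y : T) (w : seq T).

Definition adj w := count (fun xy => r xy.1 xy.2) (zip w (behead w)).

Lemma adj_cons x y w : adj [:: x, y & w] = r x y + adj (y :: w).
Proof. by []. Qed.

Lemma adj_cat x a b : adj (a ++ x :: b) = adj (rcons a x) + adj (x :: b).
Proof.
elim: a => [//|y [|z a] IH]; first by rewrite /= !adj_cons addn0.
by rewrite /= !adj_cons -addnA -IH.
Qed.

Lemma adj_rcons w x y : adj (rcons (rcons w x) y) = adj (rcons w x) + r x y.
Proof. by rewrite -cats1 cat_rcons adj_cat adj_cons addn0. Qed.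

End Adjacent.

Lemma adj_rev T (r : rel T) w : adj r (rev w) = adj (fun x y => r y x) w.
Proof.
elim: w => [//|x [//|y w] IH].
by rewrite !rev_cons adj_rcons -rev_cons IH adj_cons addnC.
Qed.

Lemma adj_map (T U : eqType) (r : rel T) (r' : rel U) (g : U -> T) w :
  {in w &, {mono g : x y / r' x y >-> r x y}} -> adj r (map g w) = adj r' w.
Proof.
elim: w => [//|x [//|y w] IH] rg; rewrite !map_cons !adj_cons -map_cons IH.
  by rewrite rg // !inE eqxx ?orbT.
by apply: sub_in2 rg => z zw; rewrite inE zw orbT.
Qed.

Lemma sdesE w : sdes w = adj (fun x y => y < x) w. Proof. by []. Qed.
Lemma sascE w : sasc w = adj ltn w. Proof. by []. Qed.

Lemma sdes_rev w : sdes (rev w) = sasc w. Proof. by rewrite sdesE adj_rev. Qed.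
Lemma sasc_rev w : sasc (rev w) = sdes w. Proof. by rewrite sascE adj_rev. Qed.

Lemma sdes_sasc w : uniq w -> sdes w + sasc w = (size w).-1.
Proof.
rewrite sdesE sascE; elim: w => [//|x [//|y w] IH] /= /andP[].
rewrite inE negb_or => /andP[neq _] /IH; rewrite !adj_cons /=.
by case: ltngtP neq => //=; lia.
Qed.

Definition mono_on (g : nat -> nat) (w : seq nat) := {in w &, {mono g : x y / x < y}}.

Lemma sdes_map g w : mono_on g w -> sdes (map g w) = sdes w.
Proof. by move=> mg; rewrite !sdesE; apply: adj_map => x y xw yw; apply: mg. Qed.
Lemma sasc_map g w : mono_on g w -> sasc (map g w) = sasc w.
Proof. by move=> mg; rewrite !sascE; apply: adj_map => x y xw yw; apply: mg. Qed.

Fixpoint desc n : seq nat := if n is n'.+1 then n' :: desc n' else [::].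

Lemma mem_desc n x : (x \in desc n) = (x < n).
Proof. by elim: n => //= n IH; rewrite in_cons IH ltnS [RHS]leq_eqVlt. Qed.

Lemma desc_uniq n : uniq (desc n).
Proof. by elim: n => //= n ->; rewrite mem_desc ltnn. Qed.

Lemma size_desc n : size (desc n) = n. Proof. by elim: n => //= n ->. Qed.

Lemma desc_sorted n : sorted gtn (desc n).
Proof.
elim: n => //= n; rewrite (path_sortedE (rev_trans ltn_trans)) => ->.
by rewrite andbT; apply/allP => x; rewrite mem_desc.
Qed.

Lemma mem_splits (T : eqType) (s : seq T) c :
  c \in splits s -> subseq c.1 s /\ subseq c.2 s.
Proof.
elim: s c => [|x s IH] c /=; first by rewrite inE => /eqP->.
rewrite mem_cat => /orP[] /mapP[c' /IH[sub1 sub2] ->] /=; rewrite eqxx; split=> //.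
  exact: subseq_trans sub2 (subseq_cons _ _).
exact: subseq_trans sub1 (subseq_cons _ _).
Qed.

(** * Generating functions of order-invariant weights *)

Section WordSums.
Variable R : comNzRingType.
Local Open Scope ring_scope.

(** Such a weight sees only the relative order of the letters, so it can be summed over any alphabet
    of the right size. *)
Definition order_inv (f : seq nat -> R) := forall g w, mono_on g w -> f (map g w) = f w.

Definition wsum (f : seq nat -> R) n := \sum_(w <- perms (desc n)) f w.

Lemma eq_wsum f g n : {in perms (desc n), f =1 g} -> wsum f n = wsum g n.
Proof. by move=> efg; apply: eq_big_seq. Qed.

Lemma wsum_rev f n : wsum (f \o rev) n = wsum f n.
Proof. by rewrite /wsum sum_perms_rev // desc_uniq. Qed.

Lemma sum_perms_sorted f s : order_inv f -> sorted gtn s ->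
  \sum_(w <- perms s) f w = wsum f (size s).
Proof.
(* Since [rev s] is increasing, [g] sends [i] to the letter of rank [i] in [s]; the default [0] is
   not reached on [desc (size s)]. *)
move=> inv_f sort_s; pose g := nth 0%N (rev s).
have def_s : s = map g (desc (size s)).
  rewrite {}/g; elim: s sort_s => //= x s IH ps.
  rewrite rev_cons nth_rcons size_rev ltnn eqxx; congr cons.
  rewrite [LHS]IH ?(path_sorted ps) //; apply/eq_in_map => i.
  by rewrite mem_desc nth_rcons size_rev => ->.
rewrite {1}def_s perms_map big_map; apply: eq_big_seq => w.
rewrite mem_perms => /perm_mem ew; apply: inv_f => i j.
rewrite !ew !mem_desc => lt_i lt_j; rewrite /g.
have inc : {homo nth 0%N (rev s) : i j / (i < j < size s)%N >-> (i < j)%N}.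
  move=> a b /andP[lt_ab lt_b]; apply: (sorted_ltn_nth ltn_trans) => //.
  - by rewrite rev_sorted.
  - by rewrite inE size_rev (ltn_trans lt_ab).
  - by rewrite inE size_rev.
case: (ltngtP i j) => [lt_ij|lt_ij|->]; last by rewrite ltnn.
  by rewrite inc ?lt_ij.
by rewrite ltnNge ltnW // inc ?lt_ij.
Qed.

(** Splits with prescribed sizes are counted by a binomial coefficient; the side chosen for the head
    letter gives the two terms of the Leibniz rule. *)
Lemma conv_splits (T : Type) (f g : nat -> R) (s : seq T) :
  \sum_(c <- splits s) f (size c.1) * g (size c.2) = conv f g (size s).
Proof.
elim: s f g => [|x s IH] f g; first exact: big_seq1.
rewrite /= big_cat !big_map -(IH (dseq f)) -(IH f (dseq g)).
by congr (_ + _); apply: eq_bigr.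
Qed.

Lemma conv_wsum f g n : order_inv f -> order_inv g ->
  \sum_(c <- splits (desc n)) \sum_(a <- perms c.1) \sum_(b <- perms c.2) f a * g b =
  conv (wsum f) (wsum g) n.
Proof.
move=> inv_f inv_g; rewrite -[n in RHS]size_desc -conv_splits.
apply: eq_big_seq => c /mem_splits[sub1 sub2].
rewrite -!sum_perms_sorted //; last 2 first.
- exact: subseq_sorted (rev_trans ltn_trans) _ _ sub2 (desc_sorted n).
- exact: subseq_sorted (rev_trans ltn_trans) _ _ sub1 (desc_sorted n).
by rewrite big_distrl; apply: eq_bigr => a _; rewrite big_distrr.
Qed.

Lemma wsumS (f : seq nat -> R) n : wsum f n.+1 =
  \sum_(c <- splits (desc n)) \sum_(a <- perms c.1) \sum_(b <- perms c.2) f (a ++ n :: b).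
Proof. exact: sum_perms_cons. Qed.

Lemma mem_split_perms n c a b : c \in splits (desc n) ->
  a \in perms c.1 -> b \in perms c.2 ->
  [/\ uniq a, uniq b, {in a, forall x, x < n} & {in b, forall x, x < n}]%N.
Proof.
move=> /mem_splits[sub1 sub2]; rewrite !mem_perms => ea eb.
have u := desc_uniq n.
rewrite (perm_uniq ea) (perm_uniq eb) !(subseq_uniq _ u) //.
by split=> // x; rewrite (perm_mem ea, perm_mem eb) => /(mem_subseq _) => /(_ (desc n));
  rewrite mem_desc; apply.
Qed.

(** Removing the largest letter differentiates the generating function, so a weight that factors
    around this letter has a product as derivative. *)
Lemma wsum_conv (h f g : seq nat -> R) n : order_inv f -> order_inv g ->
  (forall a b, uniq a -> uniq b -> {in a, forall x, x < n}%N ->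
     {in b, forall x, x < n}%N -> h (a ++ n :: b) = f a * g b) ->
  wsum h n.+1 = conv (wsum f) (wsum g) n.
Proof.
move=> inv_f inv_g hfg; rewrite wsumS -conv_wsum //.
apply: eq_big_seq => c sc; apply: eq_big_seq => a ac; apply: eq_big_seq => b bc.
by case: (mem_split_perms sc ac bc) => *; apply: hfg.
Qed.

End WordSums.

(** * Ballot words *)

Section Height.
Local Open Scope ring_scope.

(** The equivalence packages existence and uniqueness of the first minimum, because cut positions
    must later be recognized as this index. *)
Lemma first_argmin (h : nat -> int) m : exists2 i0, (i0 <= m)%N &
  forall i, (i <= m)%N ->
  ((forall j, (j <= m)%N -> if (j < i)%N then h i < h j else h i <= h j) <-> i = i0).
Proof.
elim: m => [|m [i0 le_i0 IH]].
  by exists 0%N => // -[|i] // _; split=> // _ [|j] //=; rewrite lexx.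
have [_ /(_ erefl) min_i0] := IH i0 le_i0.
have [lt_h|le_h] := ltP (h m.+1) (h i0).
  exists m.+1 => // i le_i; split=> [min_i|-> j].
    have := min_i m.+1 (leqnn _); have := min_i i0 (leqW le_i0).
    by have := min_i0 i; do ![case: ifP]; lia.
  rewrite leq_eqVlt => /orP[/eqP->|lt_j]; first by rewrite ltnn.
  by have := min_i0 j; do ![case: ifP]; lia.
exists i0; first exact: leqW.
move=> i; rewrite leq_eqVlt => /orP[/eqP->|lt_i].
  split=> [/(_ i0 (leqW le_i0))|e]; last by rewrite -e ltnn in le_i0.
  by rewrite ltnS le_i0; lia.
split=> [min_i|-> j].
  by apply/(IH i lt_i) => j le_j; apply: min_i; apply: leqW.
rewrite leq_eqVlt => /orP[/eqP->|lt_j]; last exact: min_i0.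
by rewrite le_h ifN // -leqNgt leqW.
Qed.

Lemma last_argmin (h : nat -> int) m : exists2 i0, (i0 <= m)%N &
  forall i, (i <= m)%N ->
  ((forall j, (j <= m)%N -> if (i < j)%N then h i < h j else h i <= h j) <-> i = i0).
Proof.
have [i0 le_i0 min_i0] := first_argmin (fun i => h (m - i)%N) m.
exists (m - i0)%N => [|i le_i]; first exact: leq_subr.
have [min1 min2] := min_i0 (m - i)%N (leq_subr _ _).
rewrite subKn // in min1 min2.
split=> [min_i|e].
  rewrite -min1 ?subKn // => j le_j; have := min_i (m - j)%N (leq_subr _ _).
  by do ![case: ifP]; lia.
move=> j le_j; have := min2 _ (m - j)%N (leq_subr _ _); rewrite subKn //.
by do ![case: ifP]; lia.
Qed.

End Height.

(** The height may be negative, hence the integers; index [i] refers to the prefix of [i.+1]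
    letters. *)
Definition height (w : seq nat) i : int :=
  ((sasc (take i.+1 w))%:Z - (sdes (take i.+1 w))%:Z)%R.

Definition bal (w : seq nat) :=
  all (fun i => sdes (take i.+1 w) <= sasc (take i.+1 w)) (iota 0 (size w)).

Lemma balP w : reflect (forall i, i < size w -> (0 <= height w i)%R) (bal w).
Proof.
apply: (iffP allP) => [bw i lt_i|bw i].
  by have := bw i; rewrite mem_iota lt_i /height => /(_ erefl); lia.
by rewrite mem_iota /= => /bw; rewrite /height; lia.
Qed.

Lemma adj_take (T : Type) (r : rel T) w i j : i <= j < size w ->
  adj r (take j.+1 w) =
  adj r (take i.+1 w) + adj r (take (j - i).+1 (drop i w)).
Proof.
case: w => [|x0 w0]; first by rewrite andbC.
set w := x0 :: w0 => /andP[le_ij lt_j]; have lt_i := leq_ltn_trans le_ij lt_j.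
have -> : j.+1 = i + (j - i).+1 by rewrite addnS subnKC.
by rewrite takeD (drop_nth x0 lt_i) (take_nth x0 lt_i) /= adj_cat.
Qed.

Lemma height_drop w i j : i <= j < size w ->
  height (drop i w) (j - i) = (height w j - height w i)%R.
Proof.
move=> ij; rewrite /height !sdesE !sascE !(adj_take _ ij); lia.
Qed.

(** Reversal exchanges ascents and descents, so walking back from [k] to [j] undoes the steps from
    [j] to [k]. *)
Lemma height_rev_take w k j : j <= k < size w ->
  height (rev (take k.+1 w)) (k - j) = (height w j - height w k)%R.
Proof.
move=> jk; rewrite /height take_rev size_takel; last by lia.
have -> : k.+1 - (k - j).+1 = j by lia.
have -> : drop j (take k.+1 w) = take (k - j).+1 (drop j w).
  by rewrite take_drop addSn subnK //; case/andP: jk.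
rewrite sdes_rev sasc_rev.
rewrite !sdesE !sascE !(adj_take _ jk); lia.
Qed.

Lemma bal_drop w i : reflect
  (forall j, i <= j < size w -> (height w i <= height w j)%R) (bal (drop i w)).
Proof.
apply: (iffP (balP _)) => bw j; rewrite ?size_drop => lt_j.
  have := bw (j - i); rewrite size_drop height_drop // => /(_ _); lia.
have := bw (j + i); have := @height_drop w i (j + i).
rewrite addnK; lia.
Qed.

Lemma bal_rev_take w k : k < size w -> reflect
  (forall j, j <= k -> (height w k <= height w j)%R) (bal (rev (take k.+1 w))).
Proof.
move=> lt_k; apply: (iffP (balP _)) => bw j; rewrite ?size_rev ?size_takel // => lt_j.
  have := bw (k - j); rewrite size_rev size_takel // height_rev_take; lia.
have := bw (k - j); have := @height_rev_take w k (k - j).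
rewrite subKn; lia.
Qed.

(** * Weights of ballot words and cuts at minimal height *)

Section Weights.
Local Open Scope ring_scope.

(** This counts the step between a word and an adjacent larger letter, which is absent for the empty
    word. *)
Definition nonnil (w : seq nat) : nat := (w != [::]).
Definition wdes (w : seq nat) : {poly int} := 'X^(sdes w).
Definition wdes1 (w : seq nat) : {poly int} := 'X^(nonnil w + sdes w).
Definition wbal (w : seq nat) : {poly int} := if bal w then 'X^(sdes w) else 0.
Definition wbal1 (w : seq nat) : {poly int} :=
  if bal w then 'X^(nonnil w + sasc w) else 0.

Lemma nonnil_map g w : nonnil (map g w) = nonnil w. Proof. by case: w. Qed.
Lemma nonnil_rev w : nonnil (rev w) = nonnil w.
Proof. by rewrite /nonnil -!size_eq0 size_rev. Qed.

Lemma sdes_rcons_max a n : {in a, forall x, x < n}%N -> sdes (rcons a n) = sdes a.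
Proof.
case/lastP: a => // a x lt_a; rewrite !sdesE adj_rcons /= ltnNge ltnW ?addn0 //.
by apply: lt_a; rewrite mem_rcons mem_head.
Qed.

Lemma sasc_rcons_max a n : {in a, forall x, x < n}%N ->
  sasc (rcons a n) = (nonnil a + sasc a)%N.
Proof.
case/lastP: a => // a x lt_a; rewrite !sascE adj_rcons /= lt_a ?mem_rcons ?mem_head //.
by rewrite addnC /nonnil; case: (a).
Qed.

Lemma sdes_cons_max b n : {in b, forall x, x < n}%N ->
  sdes (n :: b) = (nonnil b + sdes b)%N.
Proof. by case: b => // x b lt_b; rewrite sdesE adj_cons lt_b ?mem_head. Qed.

Lemma bal_map g w : mono_on g w -> bal (map g w) = bal w.
Proof.
move=> mg; rewrite /bal size_map; apply: eq_all => i.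
rewrite -map_take; suff mgt : mono_on g (take i.+1 w).
  by rewrite sdes_map // sasc_map.
by apply: sub_in2 mg => x /mem_take.
Qed.

Lemma order_inv_wdes : order_inv wdes.
Proof. by move=> g w mg; rewrite /wdes sdes_map. Qed.
Lemma order_inv_wdes1 : order_inv wdes1.
Proof. by move=> g w mg; rewrite /wdes1 nonnil_map sdes_map. Qed.
Lemma order_inv_wbal : order_inv wbal.
Proof. by move=> g w mg; rewrite /wbal bal_map ?sdes_map. Qed.
Lemma order_inv_wbal1 : order_inv wbal1.
Proof. by move=> g w mg; rewrite /wbal1 bal_map // nonnil_map sasc_map. Qed.

Lemma sum_if_pred1 (V : nmodType) m (p : pred nat) i0 (x : V) : (i0 < m)%N ->
  (forall i, (i < m)%N -> p i = (i == i0)) ->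
  \sum_(0 <= i < m) (if p i then x else 0) = x.
Proof.
move=> lt_i0 pE; rewrite big_mkord (bigD1 (Ordinal lt_i0)) //= pE // eqxx.
by rewrite big1 ?addr0 // => i; rewrite -val_eqE /= pE // => /negPf->.
Qed.

Lemma adj_step (r : rel nat) w k : (k.+1 < size w)%N ->
  adj r w = (adj r (take k.+1 w) + r (nth 0 w k) (nth 0 w k.+1)
             + adj r (drop k.+1 w))%N.
Proof.
move=> lt_k; rewrite -[w in LHS](cat_take_drop k.+1 w) (drop_nth 0%N lt_k) adj_cat.
by rewrite (take_nth 0%N (ltnW lt_k)) adj_rcons.
Qed.

Lemma height_step w k : uniq w -> (k.+1 < size w)%N ->
  height w k.+1 = if (nth 0 w k.+1 < nth 0 w k)%N then height w k - 1 else height w k + 1.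
Proof.
move=> uw lt_k; have lt_k' := ltnW lt_k.
have : nth 0%N w k.+1 != nth 0%N w k by rewrite nth_uniq // gtn_eqF.
rewrite /height !(take_nth 0%N lt_k) !(take_nth 0%N lt_k') !sdesE !sascE !adj_rcons /=.
by case: ltngtP => //= _ _; lia.
Qed.

(* Cutting [w] between two letters, one of them at the minimal height, splits it
   into a reversed ballot word and a ballot word. The cut is a descent into the
   first minimum or an ascent out of the last one, and both are unique. *)
Lemma sum_cuts_ballot w : uniq w -> w != [::] ->
  \sum_(c <- cuts w) wbal1 (rev c.1) * wbal c.2 = (1 + 'X) * 'X^(sdes w).
Proof.
move=> uw w0; pose h := height w; pose m := (size w).-1.
have sw : size w = m.+1 by rewrite /m prednK // lt0n size_eq0.
have [i0 le_i0 min_i0] := first_argmin h m.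
have [i1 le_i1 min_i1] := last_argmin h m.
rewrite cutsE big_map sw -[iota _ _]/(index_iota 0 m.+2).
(* The cut just before the first minimum contributes [x], the cut just after the last one
   contributes [y], and all others contribute zero. *)
pose x : {poly int} := 'X^(sdes w); pose y : {poly int} := 'X^((sdes w).+1).
have termE i : (i < m.+2)%N -> wbal1 (rev (take i w)) * wbal (drop i w) =
    (if i == i0 then x else 0) + (if (0 < i)%N && (i.-1 == i1) then y else 0).
  (* A ballot suffix at [j] with only strictly greater heights before it makes [j] the first
     minimum; [lminP] is the mirror image. *)
  have fminP j : (j <= m)%N -> bal (drop j w) ->
      (forall j', (j' < j)%N -> h j < h j') -> j = i0.
    move=> le_j /bal_drop bw lt_h; apply/(min_i0 j le_j) => j' le_j'.
    by case: ifP => [/lt_h//|?]; apply: bw; rewrite sw; lia.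
  have lminP j : (j <= m)%N -> bal (rev (take j.+1 w)) ->
      (forall j', (j < j' <= m)%N -> h j < h j') -> j = i1.
    move=> le_j /bal_rev_take bw lt_h; apply/(min_i1 j le_j) => j' le_j'.
    case: ifP => lt_j; first by apply: lt_h; rewrite lt_j.
    by apply: bw; rewrite ?sw; lia.
  have {min_i0} [_ /(_ erefl) min_i0] := min_i0 i0 le_i0.
  have {min_i1} [_ /(_ erefl) min_i1] := min_i1 i1 le_i1.
  have bal_i0 : bal (drop i0 w).
    by apply/bal_drop => j; rewrite sw => ?; have := min_i0 j; rewrite -/h; case: ifP; lia.
  have bal_i1 : bal (rev (take i1.+1 w)).
    by apply/bal_rev_take; rewrite ?sw // => j ?; have := min_i1 j; rewrite -/h; case: ifP; lia.
  (* The two extreme cuts are treated apart; their empty side has weight one. *)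
  case: i => [|k] lt_i.
    rewrite take0 drop0 /= addr0 {1}/wbal1 /= mul1r /wbal.
    case: ifPn => [bw|nbw]; first by rewrite -(fminP 0%N) ?drop0.
    by case: eqP => // e; rewrite -e drop0 (negPf nbw) in bal_i0.
  have lt_k : (k < size w)%N by rewrite sw.
  rewrite [_ && _]/= /wbal1 nonnil_rev sasc_rev.
  have -> : nonnil (take k.+1 w) = 1%N by rewrite /nonnil -size_eq0 size_takel.
  move: lt_i; rewrite ltnS leq_eqVlt => /predU1P[[ek]|lt_i].
    rewrite drop_oversize ?take_oversize ?sw ?ek // /wbal /= mulr1.
    rewrite [m.+1 == i0]gtn_eqF // add0r /y add1n.
    case: ifPn => [bw|nbw].
      rewrite -(lminP m) ?eqxx // ?take_oversize ?sw // => j.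
      by rewrite ltnNge andbC; case: leqP.
    by case: eqP => // e; rewrite -e take_oversize ?sw // (negPf nbw) in bal_i1.
  have lt_kw : (k.+1 < size w)%N by rewrite sw.
  have hk := height_step uw lt_kw; rewrite -/(h k) -/(h k.+1) in hk.
  have dk := adj_step (fun x y => (y < x)%N) lt_kw; rewrite -!sdesE in dk.
  rewrite /x /y dk.
  (* At a descent [k] cannot be the last minimum, and the [1] from [nonnil] makes up for the descent
     lost in the cut. At an ascent [k.+1] cannot be the first minimum, and this [1] lifts the
     exponent to [(sdes w).+1]. *)
  case: ltnP hk => [_|_] hk; rewrite ?addn1 ?addn0.
  - have -> : (k == i1) = false.
      apply/eqP => e; have := min_i1 k.+1 lt_i; rewrite -e ltnSn; lia.
    rewrite addr0; case: (eqVneq k.+1 i0) => [e|ne].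
      subst i0; rewrite /wbal bal_i0 ifT -?exprD ?add1n //.
      apply/bal_rev_take => // j le_j.
      by have := min_i0 j; rewrite ltnS le_j -/h; lia.
    case: ifP => [/bal_rev_take bw|]; last by rewrite mul0r.
    rewrite /wbal; case: ifP => [bw'|]; last by rewrite mulr0.
    case/eqP: ne; apply: fminP => // j lt_j; have := bw lt_k j; rewrite -/h; lia.
  - have -> : (k.+1 == i0) = false.
      by apply/eqP => e; have := min_i0 k (ltnW lt_i); rewrite -e ltnSn; lia.
    rewrite add0r; case: (eqVneq k i1) => [e|ne].
      subst i1; rewrite bal_i1 /wbal ifT -?exprD ?add1n //.
      apply/bal_drop => j /andP[lt_j lt_jw].
      by have := min_i1 j; rewrite lt_j -/h -ltnS -sw lt_jw; lia.
    case: ifP => [bw'|]; last by rewrite mul0r.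
    rewrite /wbal; case: ifP => [/bal_drop bw|]; last by rewrite mulr0.
    case/eqP: ne; apply: lminP => //; first exact: ltnW.
    move=> j lt_j; have := bw j; rewrite -/h sw; lia.
rewrite big_nat (eq_bigr _ (fun i lt_i => termE i lt_i)) -big_nat big_split /=.
rewrite big_nat_recr //= (sum_if_pred1 _ (i0 := i0)) // gtn_eqF ?ltnS ?addr0 //.
rewrite big_nat_recl //= add0r (sum_if_pred1 _ (i0 := i1)) //.
by rewrite mulrDl mul1r -exprS.
Qed.

Definition eul := wsum wdes.
Definition balseq := wsum wbal.
Definition balseq1 := wsum wbal1.

Lemma perms_desc n w : w \in perms (desc n) -> uniq w /\ size w = n.
Proof.
by rewrite mem_perms => e; rewrite (perm_uniq e) (perm_size e) desc_uniq size_desc.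
Qed.

(** By [sum_splits], arranging both sides of a split amounts to cutting a word, and reversing the
    left side only permutes its arrangements; [sum_cuts_ballot] then evaluates each word. *)
Lemma conv_balseq n : conv balseq1 balseq n = if n is 0 then 1 else (1 + 'X) * eul n.
Proof.
rewrite -conv_wsum; [|exact: order_inv_wbal1|exact: order_inv_wbal].
transitivity (\sum_(w <- perms (desc n)) \sum_(c <- cuts w) wbal1 (rev c.1) * wbal c.2).
  rewrite -(sum_splits _ (fun a b => wbal1 (rev a) * wbal b)).
  apply: eq_big_seq => c /mem_splits[sub1 _].
  rewrite -(sum_perms_rev (fun a => \sum_(b <- perms c.2) wbal1 a * wbal b)) //.
  exact: subseq_uniq sub1 (desc_uniq n).
case: n => [|n]; first by rewrite !big_seq1 /wbal1 /wbal /= mulr1.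
rewrite mulr_sumr; apply: eq_big_seq => w /perms_desc[uw sw].
by rewrite sum_cuts_ballot // -size_eq0 sw.
Qed.

(** The largest letter makes no descent with what precedes it and one with a nonempty remainder. *)
Lemma eulS n : eul n.+1 = conv eul (wsum wdes1) n.
Proof.
apply: wsum_conv => [||a b ua ub a_lt b_lt]; first exact: order_inv_wdes.
  exact: order_inv_wdes1.
rewrite /wdes /wdes1 -exprD sdesE adj_cat -!sdesE.
by rewrite sdes_rcons_max ?sdes_cons_max.
Qed.

End Weights.

(** * The recurrence for ballot words *)

Section BallotRecurrence.
Local Open Scope ring_scope.

(* [wcyc w] is the weight of the cycle made of [w] and a letter larger than all
   those of [w]. *)
Definition wcyc (w : seq nat) : {poly int} :=
  if odd (size w) then 0 else 'X^(nonnil w + minn (sdes w) (sasc w)).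
(** The companion of [wcyc]: on a nonempty word of even length the two are ['X^((sdes w).+1)] and
    ['X^((sasc w).+1)] in some order, on the empty word [1] and ['X]. *)
Definition wcyc_hi (w : seq nat) : {poly int} :=
  if odd (size w) then 0 else 'X^((maxn (sdes w) (sasc w)).+1).

Lemma order_inv_wcyc : order_inv wcyc.
Proof. by move=> g w mg; rewrite /wcyc size_map nonnil_map sdes_map ?sasc_map. Qed.

Lemma sdes_sasc_perms n w : w \in perms (desc n) -> (sdes w + sasc w)%N = n.-1.
Proof. by case/perms_desc=> uw sw; rewrite sdes_sasc ?sw. Qed.

Lemma nonnil_perms n w : w \in perms (desc n) -> nonnil w = (0 < n)%N.
Proof. by case/perms_desc=> _ sw; rewrite /nonnil -size_eq0 sw lt0n. Qed.

Lemma wsum_le f n m : (forall w, w \in perms (desc n) -> poly_le (f w) m) ->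
  poly_le (wsum f n) m.
Proof.
by move=> lef b lt_b; rewrite coef_sum big_seq big1 // => w /lef; apply.
Qed.

Lemma wsum_ge f n m : (forall w, w \in perms (desc n) -> poly_ge (f w) m) ->
  poly_ge (wsum f n) m.
Proof.
by move=> gef b lt_b; rewrite coef_sum big_seq big1 // => w /gef; apply.
Qed.

Lemma poly_le_Xn k m : (k.*2 <= m)%N -> poly_le 'X^k m.
Proof. by move=> le_k b lt_b; rewrite coefXn; case: eqP => // e; lia. Qed.

Lemma poly_ge_Xn k m : (m <= k.*2)%N -> poly_ge 'X^k m.
Proof. by move=> le_k b lt_b; rewrite coefXn; case: eqP => // e; lia. Qed.

Lemma bal_le w : bal w -> (sdes w <= sasc w)%N.
Proof.
case: w => // x w /allP/(_ (size w)); rewrite mem_iota /= ltnSn => /(_ erefl).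
by rewrite take_size.
Qed.

(** In positive even length [sdes w + sasc w] is odd, so the smaller term is at most [n / 2 - 1] and
    the larger at least [n / 2]; this also gives [wcyc_hi_ge]. *)
Lemma wcyc_le n : poly_le (wsum wcyc n) n.
Proof.
apply: wsum_le => w wn; rewrite /wcyc (nonnil_perms wn).
have [_ ->] := perms_desc wn; have := sdes_sasc_perms wn.
case: ifPn => [_ _ b _|]; first by rewrite coef0.
by move=> even_n e; apply: poly_le_Xn; case: n even_n e {wn} => //; lia.
Qed.

Lemma wcyc_hi_ge n : poly_ge (wsum wcyc_hi n) n.+2.
Proof.
apply: wsum_ge => w wn; rewrite /wcyc_hi.
have [_ ->] := perms_desc wn; have := sdes_sasc_perms wn.
case: ifPn => [_ _ b _|]; first by rewrite coef0.
by move=> even_n e; apply: poly_ge_Xn; case: n even_n e {wn} => //; lia.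
Qed.

(** In a ballot word of length [n.+1] the descents do not outnumber the ascents, and together they
    are [n]. *)
Lemma balseq_le n : poly_le (balseq n.+1) n.
Proof.
apply: wsum_le => w wn; rewrite /wbal; have := sdes_sasc_perms wn.
case: ifP => [/bal_le le_w e|_ _ b _]; last by rewrite coef0.
by apply: poly_le_Xn; lia.
Qed.

Lemma balseq1_ge n : poly_ge (balseq1 n.+1) n.+2.
Proof.
apply: wsum_ge => w wn; rewrite /wbal1; have := sdes_sasc_perms wn.
case: ifP => [/bal_le le_w e|_ _ b _]; last by rewrite coef0.
by apply: poly_ge_Xn; rewrite (nonnil_perms wn); lia.
Qed.

Lemma wsum0 (f : seq nat -> {poly int}) : wsum f 0 = f [::].
Proof. exact: big_seq1. Qed.

Definition eul0 n : {poly int} := if n is 0 then 0 else eul n.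

Lemma dseq_eul0 : dseq eul0 =1
  conv (addseq (cseq 1) eul0) (addseq (cseq 1) (conv (cseq 'X) eul0)).
Proof.
move=> n; rewrite -[LHS]/(eul n.+1) eulS; apply: eq_conv => -[|k].
- by rewrite /addseq /= addr0 /eul wsum0.
- by rewrite /addseq /= add0r.
- by rewrite /addseq conv_cseq /= mulr0 addr0 wsum0.
rewrite /addseq conv_cseq /= add0r mulr_sumr.
by apply: eq_wsum => w wk; rewrite /wdes1 (nonnil_perms wk) exprS.
Qed.

(** This splits the logarithmic derivative of [Q] by degree. The sum [P(x) + P(-x)] keeps each even
    length twice; one copy is counted by [sdes], the other, after reversal, by [sasc]. *)
Lemma addseq_wcyc : addseq (wsum wcyc) (wsum wcyc_hi) =1
  addseq (addseq (cseq 1) (cseq 'X)) (conv (cseq 'X) (addseq eul0 (altseq eul0))).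
Proof.
case=> [|n]; rewrite /addseq conv_cseq /altseq /=.
  by rewrite !wsum0 /wcyc /wcyc_hi /= expr0 expr1 !mulr0 !addr0 mulr0 addr0.
rewrite addr0 add0r -big_split.
have [odd_n|even_n] := boolP (odd n.+1).
  rewrite -signr_odd odd_n expr1 mulN1r subrr mulr0 big_seq big1 // => w wn.
  by have [_ sw] := perms_desc wn; rewrite /wcyc /wcyc_hi sw odd_n /= addr0.
rewrite -signr_odd (negPf even_n) expr0 mul1r mulrDr.
have es : wsum (fun w => 'X^(sasc w)) n.+1 = eul n.+1.
  by rewrite -[RHS]wsum_rev; apply: eq_wsum => w _; rewrite /wdes /= sdes_rev.
rewrite -{2}es.
rewrite !mulr_sumr -big_split; apply: eq_big_seq => w wn.
have [_ sw] := perms_desc wn.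
rewrite /wcyc /wcyc_hi sw (negPf even_n) (nonnil_perms wn) /= add1n -!exprS.
by case: (leqP (sdes w) (sasc w)) => // _; rewrite addrC.
Qed.

Lemma dseq_balseq : dseq balseq =1 conv balseq (wsum wcyc).
Proof.
apply: (wiener_hopf (g := balseq1) (b := wsum wcyc_hi)).
- by rewrite /balseq wsum0.
- by rewrite /balseq1 wsum0.
- exact: balseq_le.
- exact: balseq1_ge.
- exact: wcyc_le.
- exact: wcyc_hi_ge.
pose S := addseq (cseq 1) (cseq 'X : nat -> {poly int}).
have eQ : conv balseq balseq1 =1 addseq (cseq 1) (conv S eul0).
  have eS : S =1 cseq (1 + 'X) by case=> [|k]; rewrite /S /addseq //= addr0.
  move=> n; rewrite convC conv_balseq /addseq (eq_conv eS (frefl _)) conv_cseq.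
  by case: n => [|n] /=; rewrite ?mulr0 ?addr0 ?add0r.
move=> n; rewrite (eq_conv eQ addseq_wcyc) -(dseq_eulerian (erefl : eul0 0%N = 0) dseq_eul0).
exact: eQ.
Qed.

End BallotRecurrence.

(** * Words as products of cycles *)

Section Blocks.
Variables (T : eqType) (r : rel T).
Implicit Types (x y : T) (w : seq T).

(* Foata's map: the blocks of [w] ending at its right-to-left [r]-maxima, read
   as cycles. *)
Fixpoint blocks w : seq (seq T) :=
  if w is y :: w' then
    if blocks w' is c :: cs then
      if r y (last y c) then (y :: c) :: cs else [:: [:: y], c & cs]
    else [:: [:: y]]
  else [::].

Lemma flatten_blocks w : flatten (blocks w) = w.
Proof. by elim: w => //= y w; case: (blocks w) => [|c cs] /= <- //; case: ifP. Qed.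

Lemma blocks_neq0 w : [::] \notin blocks w.
Proof.
elim: w => //= y w; case: (blocks w) => //= c cs; rewrite !inE negb_or.
by case/andP=> c0 cs0; case: ifP; rewrite !inE ?negb_or /= ?c0 ?cs0.
Qed.

(** The next block ends at a letter that is not above [x], so [x] opens a block of its own; the
    earlier letters join it because it keeps ending at [x]. *)
Lemma blocks_max x a b : {in a, forall y, r y x} -> {in b, forall y, ~~ r x y} ->
  blocks (a ++ x :: b) = rcons a x :: blocks b.
Proof.
move=> ax xb; elim: a ax => [_|y a IH ax] /=.
  have := flatten_blocks b; have := blocks_neq0 b.
  case: (blocks b) => [|[|z c] cs] nb def_b /=; rewrite ?inE // in nb *.
  have zb : last z c \in b by rewrite -def_b /= -cat_cons mem_cat mem_last.
  by rewrite (negPf (xb _ zb)).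
rewrite IH => [|z za]; last by rewrite ax // inE za orbT.
by rewrite last_rcons ax ?mem_head.
Qed.

End Blocks.

Lemma blocks_map (T U : eqType) (r : rel T) (r' : rel U) (g : U -> T) w :
  {in w &, {mono g : x y / r' x y >-> r x y}} ->
  blocks r (map g w) = map (map g) (blocks r' w).
Proof.
elim: w => //= y w IH rg; rewrite IH => [|x z xw zw]; last first.
  by rewrite rg // inE ?xw ?zw orbT.
have := flatten_blocks r' w; case: (blocks r' w) => //= c cs def_w.
rewrite last_map rg ?mem_head //; first by case: ifP.
by rewrite -def_w -cat_cons mem_cat mem_last.
Qed.

(** * Odd cycles as weighted blocks *)

Section OddWords.
Local Open Scope ring_scope.

Definition gcyc (c : seq nat) : {poly int} :=
  if odd (size c) then 'X^(minn (cdes c) (casc c)) else 0.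

Definition wodd (w : seq nat) : {poly int} := \prod_(c <- blocks ltn w) gcyc c.

Lemma zip_rcons_l (S T : Type) (s : seq S) x (t : seq T) :
  size s = size t -> zip (rcons s x) t = zip s t.
Proof. by elim: s t => [|y s IH] [|z t] //= [/IH->]. Qed.

Lemma cdes_cons y c : cdes (y :: c) = sdes (y :: rcons c y).
Proof. by rewrite /sdes -rcons_cons [behead _]/= zip_rcons_l ?size_rcons // /cdes rot1_cons. Qed.

Lemma casc_cons y c : casc (y :: c) = sasc (y :: rcons c y).
Proof. by rewrite /sasc -rcons_cons [behead _]/= zip_rcons_l ?size_rcons // /casc rot1_cons. Qed.

Lemma gcyc_rot1 c : gcyc (rot 1 c) = gcyc c.
Proof.
case: c => // x [//|y c]; rewrite rot1_cons /gcyc size_rcons /= !cdes_cons !casc_cons.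
rewrite !sdesE !sascE !adj_cons -!rcons_cons !adj_rcons.
by rewrite [in RHS]addnC [X in _ = if _ then 'X^(minn _ X) else _]addnC.
Qed.

(** A cycle has no distinguished first letter, whereas [cycle_seq] starts at a picked one. *)
Lemma gcyc_rot i c : gcyc (rot i c) = gcyc c.
Proof.
elim: i => [|i IH]; first by rewrite rot0.
have [lt_i|le_i] := ltnP i (size c); last by rewrite rot_oversize // leqW.
by rewrite rotS // gcyc_rot1.
Qed.

Lemma gcyc_map g c : mono_on g c -> gcyc (map g c) = gcyc c.
Proof.
move=> mg; rewrite /gcyc size_map; case: c mg => // x c mg.
have mg' : mono_on g (x :: rcons c x).
  by move=> y z; rewrite -rcons_cons !mem_rcons !inE !orbA !orbb -!in_cons; apply: mg.
by rewrite /= !cdes_cons !casc_cons -map_rcons -map_cons sdes_map ?sasc_map.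
Qed.

(** Closing a nonempty [a] through the larger letter [n] adds one ascent and one descent; a fixed
    point has neither. *)
Lemma gcyc_rcons_max a n : {in a, forall x, x < n}%N -> gcyc (rcons a n) = wcyc a.
Proof.
move=> a_lt; rewrite /gcyc /wcyc size_rcons /= if_neg; case: ifP => // _.
case: a a_lt => [|x a a_lt]; first by rewrite /cdes /casc /= ltnn.
have lt_x : (x < n)%N by rewrite a_lt ?mem_head.
rewrite rcons_cons cdes_cons casc_cons -2!rcons_cons !sdesE !sascE !adj_rcons.
rewrite -sdesE -sascE sdes_rcons_max // sasc_rcons_max // lt_x /= [(n < x)%N]ltnNge (ltnW lt_x).
by rewrite addn0 addn1 add1n addn_minr !add1n.
Qed.

Lemma order_inv_wodd : order_inv wodd.
Proof.
move=> g w mg; rewrite /wodd (blocks_map (r' := ltn)); last by move=> x y xw yw; apply: mg.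
rewrite big_map; apply: eq_big_seq => c cw; apply: gcyc_map.
by apply: sub_in2 mg => x xc; rewrite -(flatten_blocks ltn w); apply/flattenP; exists c.
Qed.

Definition oddseq := wsum wodd.

(** The first block is the cycle through the largest letter, and the rest of the word is decomposed
    independently of it. *)
Lemma dseq_oddseq : dseq oddseq =1 conv (wsum wcyc) oddseq.
Proof.
move=> n; apply: wsum_conv => [||a b ua ub a_lt b_lt].
- exact: order_inv_wcyc.
- exact: order_inv_wodd.
rewrite /wodd blocks_max => [|//|x /b_lt]; last by rewrite -leqNgt => /ltnW.
by rewrite big_cons gcyc_rcons_max.
Qed.

(** Both series start at one and solve the same linear differential equation. *)
Lemma balseq_oddseq : balseq =1 oddseq.
Proof.
apply: (linear_ode_unique (g := wsum wcyc)) dseq_oddseq.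
  by rewrite /balseq /oddseq !wsum0 /wodd big_nil.
by move=> n; rewrite convC dseq_balseq.
Qed.
End OddWords.

(** * Sums over permutations *)

Lemma uniq_flatten_mem (T : eqType) (cs : seq (seq T)) c :
  uniq (flatten cs) -> c \in cs -> uniq c.
Proof.
elim: cs => //= c0 cs IH; rewrite cat_uniq inE => /and3P[uc0 _ /IH IHcs].
by case/predU1P => [->|].
Qed.

Section NextPerm.
Variable T : finType.
Implicit Types (c : seq T) (cs : seq (seq T)) (p : {perm T}).

Definition next_in cs : T -> T := foldr (fun c f => next c \o f) id cs.

Lemma next_in_inj cs : uniq (flatten cs) -> injective (next_in cs).
Proof.
elim: cs => [_|c cs IH] /=; first exact: inj_id.
rewrite cat_uniq => /and3P[uc _ /IH].
by apply: inj_comp; apply: can_inj (prev_next uc).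
Qed.

Lemma next_notin c x : x \notin c -> next c x = x.
Proof. by move=> xc; rewrite next_nth (negPf xc). Qed.

Lemma next_in_notin cs x : x \notin flatten cs -> next_in cs x = x.
Proof.
elim: cs => //= c cs IH; rewrite mem_cat negb_or => /andP[xc /IH ->].
exact: next_notin.
Qed.

Lemma next_inE cs c x : uniq (flatten cs) -> c \in cs -> x \in c ->
  next_in cs x = next c x.
Proof.
elim: cs => //= c0 cs IH; rewrite cat_uniq inE => /and3P[_ dis ucs].
have notin0 y : y \in flatten cs -> y \notin c0.
  by move=> ycs; apply: contra dis => yc0; apply/hasP; exists y.
have [-> _ xc|_ /= ccs xc] := eqVneq c c0.
  by rewrite next_in_notin //; apply/negP => /notin0; rewrite xc.
by rewrite IH // next_notin // notin0 //; apply/flattenP; exists c; rewrite ?mem_next.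
Qed.

Lemma perm_of_cycles cs : uniq (flatten cs) -> exists p, all (fcycle p) cs.
Proof.
move=> ucs; exists (perm (next_in_inj ucs)); apply/allP => c ccs.
have uc := uniq_flatten_mem ucs ccs.
have e : {in [in c] &, frel (perm (next_in_inj ucs)) =2 frel (next c)}.
  by move=> x y xc yc; rewrite /= permE (next_inE ucs ccs).
by rewrite (eq_in_cycle e) ?cycle_next //; apply/allP.
Qed.

(** The order of [x] under [f] fixes the length, and iterating [f] from [x] fixes the letters. *)
Lemma fcycle_cons_inj f x (a b : seq T) : uniq (x :: a) -> uniq (x :: b) ->
  fcycle f (x :: a) -> fcycle f (x :: b) -> a = b.
Proof.
move=> ua ub ca cb; have := order_cycle ca ua (mem_head x a).
rewrite (order_cycle cb ub (mem_head x b)) => -[sab].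
move: ca cb; rewrite /= !rcons_path => /andP[/fpathE-> _] /andP[/fpathE-> _].
by rewrite sab.
Qed.

Lemma fcycle_rcons_inj f x (a b : seq T) : uniq (rcons a x) -> uniq (rcons b x) ->
  fcycle f (rcons a x) -> fcycle f (rcons b x) -> a = b.
Proof.
rewrite -!(rot1_cons x) !rot_uniq !rot_cycle; exact: fcycle_cons_inj.
Qed.

Lemma porbit_fcycle p c x : uniq c -> fcycle p c -> x \in c -> porbit p x = [set y in c].
Proof.
move=> uc cc xc; apply/setP => y; rewrite inE -(fconnect_cycle cc xc).
apply/porbitP/idP => [[i ->]|/iter_findex <-].
  by rewrite permX fconnect_iter.
by exists (findex p x y); rewrite permX.
Qed.

Lemma porbits_fcycles p cs : [::] \notin cs -> perm_eq (flatten cs) (enum T) ->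
  all (fcycle p) cs -> perm_eq (enum (porbits p)) [seq [set y in c] | c <- cs].
Proof.
move=> cs0 ecs /allP cyc_cs; have ucs : uniq (flatten cs) by rewrite (perm_uniq ecs) enum_uniq.
have uc c := uniq_flatten_mem (c := c) ucs.
apply: uniq_perm => [||A]; first exact: enum_uniq.
  elim: cs cs0 ucs {ecs cyc_cs uc} => //= c cs IH.
  rewrite inE negb_or cat_uniq => /andP[c0 cs0] /and3P[_ dis /(IH cs0) ->].
  rewrite andbT; apply/mapP => -[c' c'cs ec]; case: c c0 dis ec => // x c _ dis /setP/(_ x).
  rewrite !inE eqxx => /esym xc'; case/hasP: dis; exists x; rewrite ?mem_head //.
  by apply/flattenP; exists c'.
rewrite mem_enum; apply/imsetP/mapP => [[x _ ->]|[c ccs ->]].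
  have /flattenP[c ccs xc] : x \in flatten cs by rewrite (perm_mem ecs) mem_enum.
  by exists c => //; apply: porbit_fcycle; rewrite ?uc ?cyc_cs.
case: c ccs => [|x c] ccs; first by rewrite ccs in cs0.
by exists x => //; rewrite (@porbit_fcycle _ (x :: c)) ?uc ?cyc_cs ?mem_head.
Qed.

End NextPerm.

Lemma perm_eq_index_enum (T : finType) (s : seq T) :
  uniq s -> #|T| <= size s -> perm_eq s (index_enum T).
Proof.
move=> us le_s; apply: uniq_perm => [//||x]; first exact: index_enum_uniq.
have sub : {subset s <= enum T} by move=> y; rewrite mem_enum.
have [|_ ->] := uniq_min_size us sub; first by rewrite -cardE.
by rewrite mem_enum mem_index_enum.
Qed.

Lemma max_mem (T : eqType) (g : T -> nat) (w : seq T) : w != [::] ->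
  exists2 x, x \in w & {in w, forall y, g y <= g x}.
Proof.
elim: w => // x [|y w] IH _; first by exists x => [|y]; rewrite inE // => /eqP->.
have [//|z zw maxz] := IH; have [le_xz|lt_zx] := leqP (g x) (g z).
  by exists z => [|t]; rewrite inE ?zw ?orbT // => /predU1P[->|/maxz].
exists x => [|t]; first exact: mem_head.
rewrite inE => /predU1P[->|/maxz le_tz] //; exact: leq_trans le_tz (ltnW lt_zx).
Qed.

(** * Permutations of ordinals as words *)

Section OrdWords.
Variable n : nat.
Implicit Types (p : {perm 'I_n}) (w : seq 'I_n).

Definition ltord : rel 'I_n := fun x y => x < y.

Lemma gcyc_cycle_seq p (c : seq 'I_n) : c != [::] -> uniq c -> fcycle p c ->
  gcyc (cycle_seq p [set y in c]) = gcyc (map val c).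
Proof.
move=> c0 uc cc; rewrite /cycle_seq; case: pickP => [z|none]; last first.
  by case: c c0 {uc cc} none => // x c _ /(_ x); rewrite inE mem_head.
rewrite inE => zc; case: (rot_to zc) => i c' ec.
have : fcycle p (z :: c') by rewrite -ec rot_cycle.
rewrite /= rcons_path => /andP[/fpathE ec' _].
have -> : traject p z #|[set y in c]| = rot i c.
  by rewrite cardsE (card_uniqP uc) -(size_rot i) ec [RHS]/= ec' /= size_traject.
by rewrite map_rot gcyc_rot.
Qed.

(** The first block is the cycle of [p] through the largest letter, written so as to end there; this
    determines it, and induction determines the rest. *)
Lemma blocks_fcycle_inj p w w' : uniq w -> perm_eq w w' ->
  all (fcycle p) (blocks ltord w) -> all (fcycle p) (blocks ltord w') -> w = w'.
Proof.
have [k] := ubnP (size w); elim: k w w' => // k IH w w' lt_w uw eww'.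
have [w0|/(max_mem val)[x xw max_x]] := eqVneq w [::]; last first.
  have xw' : x \in w' by rewrite -(perm_mem eww').
  have uw' : uniq w' by rewrite -(perm_uniq eww').
  have max_x' : {in w', forall y : 'I_n, y <= x}.
    by move=> y; rewrite -(perm_mem eww'); apply: max_x.
  case/splitPr: xw lt_w uw eww' max_x => a b lt_w uw; case/splitPr: xw' uw' max_x' => a' b' uw'.
  have blocksE (u v : seq 'I_n) : uniq (u ++ x :: v) ->
      {in u ++ x :: v, forall y : 'I_n, y <= x} ->
      blocks ltord (u ++ x :: v) = rcons u x :: blocks ltord v.
    rewrite cat_uniq /= => /and3P[_ xu _] max_u; apply: blocks_max => y yin.
      rewrite /ltord ltn_neqAle max_u ?mem_cat ?yin // andbT.
      by apply: contraNneq xu => exy; rewrite -(val_inj exy) yin.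
    by rewrite /ltord -leqNgt max_u // mem_cat inE yin !orbT.
  move=> max_x' eww' max_x; rewrite !blocksE //= => /andP[ca cb] /andP[ca' cb'].
  have ea : a = a'.
    apply: fcycle_rcons_inj ca ca'.
      by move: uw; rewrite -cat_rcons cat_uniq => /andP[].
    by move: uw'; rewrite -cat_rcons cat_uniq => /andP[].
  subst a'; congr (_ ++ _ :: _); apply: IH cb cb'.
  - by move: lt_w; rewrite size_cat /=; lia.
  - by move: uw; rewrite -cat_rcons cat_uniq => /and3P[].
  - by move: eww'; rewrite perm_cat2l perm_cons.
by move: eww'; rewrite w0 perm_sym => /perm_nilP->.
Qed.

Lemma desc_ord : map val (rev (enum 'I_n)) = desc n.
Proof.
by rewrite map_rev val_enum_ord; elim: n => // k IH; rewrite -addn1 iotaD rev_cat IH addn1.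
Qed.

Lemma perms_enum_ord w : w \in perms (rev (enum 'I_n)) -> perm_eq w (enum 'I_n).
Proof. by rewrite mem_perms perm_sym perm_rev perm_sym. Qed.

(** Foata's correspondence as a change of variables: words map injectively to permutations, and
    there are [n!] of each. *)
Lemma sum_perm_blocks (R : nmodType) (F : {perm 'I_n} -> R) (G : seq 'I_n -> R) :
    (forall p w, perm_eq w (enum 'I_n) -> all (fcycle p) (blocks ltord w) -> F p = G w) ->
  (\sum_p F p = \sum_(w <- perms (rev (enum 'I_n))) G w)%R.
Proof.
move=> FG; set e := rev _.
(* The default [1%g] is not reached on [perms e], where the blocks are disjoint and [perm_of_cycles]
   yields a permutation. *)
pose phi w : {perm 'I_n} := odflt 1%g [pick p : {perm 'I_n} | all (fcycle p) (blocks ltord w)].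
have phiP w : w \in perms e -> all (fcycle (phi w)) (blocks ltord w).
  move=> /perms_enum_ord ew; rewrite /phi; case: pickP => // none.
  have [|p] := @perm_of_cycles _ (blocks ltord w); last by have := none p; rewrite /= => ->.
  by rewrite flatten_blocks (perm_uniq ew) enum_uniq.
have uphi : uniq (map phi (perms e)).
  rewrite map_inj_in_uniq ?perms_uniq ?rev_uniq ?enum_uniq // => w w' we w'e ephi.
  have ew := perms_enum_ord we; have ew' := perms_enum_ord w'e.
  apply: (blocks_fcycle_inj (p := phi w)); rewrite ?phiP //.
  - by rewrite (perm_uniq ew) enum_uniq.
  - by rewrite (perm_trans ew) // perm_sym.
  - by rewrite ephi phiP.
have phi_all : perm_eq (map phi (perms e)) (index_enum {perm 'I_n}).
  by apply: perm_eq_index_enum; rewrite // size_map size_perms size_rev size_enum_ord card_Sn.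
rewrite -(perm_big _ phi_all) big_map; apply: eq_big_seq => w we.
by apply: FG; rewrite ?phiP ?perms_enum_ord.
Qed.

(** Since [oneline] is injective and there are [n!] words, it reaches all of them. *)
Lemma sum_perm_oneline (R : nmodType) (F : seq nat -> R) :
  (\sum_(p : {perm 'I_n}) F (oneline p) = \sum_(w <- perms (desc n)) F w)%R.
Proof.
rewrite -(big_map (@oneline n) xpredT); apply: perm_big.
have mem_oneline p : oneline p \in perms (desc n).
  rewrite mem_perms -desc_ord map_rev perm_sym perm_rev perm_sym.
  rewrite /oneline (map_comp val p) perm_map //; apply: uniq_perm.
  - by rewrite map_inj_uniq ?enum_uniq //; apply: perm_inj.
  - exact: enum_uniq.
  by move=> x; rewrite mem_enum -[x](permKV p) map_f ?mem_enum.
have inj_oneline : injective (@oneline n).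
  move=> p q /eq_in_map epq; apply/permP => x; apply: val_inj; apply: epq.
  by rewrite mem_enum.
have u : uniq (map (@oneline n) (enum {perm 'I_n})) by rewrite map_inj_uniq ?enum_uniq.
apply: (@perm_trans _ (map (@oneline n) (enum {perm 'I_n}))).
  by rewrite perm_map // perm_sym perm_eq_index_enum ?enum_uniq // -cardE.
apply: uniq_perm => //; first exact/perms_uniq/desc_uniq.
have sub : {subset map (@oneline n) (enum {perm 'I_n}) <= perms (desc n)}.
  by move=> w /mapP[p _ ->].
have [|_ //] := uniq_min_size u sub.
by rewrite size_perms size_desc size_map -cardE card_Sn.
Qed.

Local Open Scope ring_scope.

(** A single orbit of even size annihilates the product; otherwise the exponents add up. *)
Lemma odd_weight p : \prod_(A in porbits p) gcyc (cycle_seq p A) =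
  if odd_order p then 'X^(Mstat p) else 0.
Proof.
have sizeE A : A \in porbits p -> size (cycle_seq p A) = #|A|.
  case/imsetP => x _ ->; rewrite /cycle_seq; case: pickP => [z _|/(_ x)].
    by rewrite size_map size_traject.
  by rewrite porbit_id.
case: ifP => [/forall_inP odd_p|/forall_inPn[A Ap even_A]].
  rewrite /Mstat -prodrXr; apply: eq_bigr => A Ap.
  by rewrite /gcyc sizeE // odd_p.
by rewrite (bigD1 A) //= /gcyc sizeE // (negPf even_A) mul0r.
Qed.

Lemma sum_odd_perm : \sum_(p : {perm 'I_n}) (if odd_order p then 'X^(Mstat p) else 0) = oddseq n.
Proof.
rewrite /oddseq /wsum -desc_ord perms_map big_map.
apply: sum_perm_blocks => p w ew cyc_w; rewrite -odd_weight.
have uw : uniq w by rewrite (perm_uniq ew) enum_uniq.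
rewrite -big_enum (perm_big _ (porbits_fcycles _ _ cyc_w)) ?blocks_neq0 ?flatten_blocks //.
rewrite big_map /wodd (blocks_map (r' := ltord)) // big_map; apply: eq_big_seq => c cw.
apply: gcyc_cycle_seq; last exact: (allP cyc_w).
  by apply: contraTneq cw => ->; apply: blocks_neq0.
by apply: uniq_flatten_mem cw; rewrite flatten_blocks.
Qed.

Lemma ballotE (p : {perm 'I_n}) : ballot p = bal (oneline p).
Proof.
have sp : size (oneline p) = n by rewrite size_map size_enum_ord.
apply/forallP/allP => [bp i|bp i]; last by apply: bp; rewrite mem_iota sp /=.
by rewrite mem_iota sp => lt_i; apply: (bp (Ordinal lt_i)).
Qed.

Lemma sum_ballot_perm : \sum_(p : {perm 'I_n}) (if ballot p then 'X^(des p) else 0) = balseq n.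
Proof.
rewrite /balseq /wsum -sum_perm_oneline; apply: eq_bigr => p _.
by rewrite ballotE.
Qed.

Lemma coef_sum_stat (A : pred {perm 'I_n}) (s : {perm 'I_n} -> nat) d :
  (\sum_p (if A p then 'X^(s p) else 0) : {poly int})`_d = #|[set p | A p && (s p == d)]|%:R.
Proof.
rewrite coef_sum -sum1_card natr_sum [RHS]big_mkcond; apply: eq_bigr => p _.
rewrite inE; case: (A p) => /=; last by rewrite coef0.
by rewrite coefXn eq_sym; case: eqP.
Qed.

End OrdWords.

Theorem theorem1p2 (n d : nat) :
  1 <= n -> d <= (n - 1)./2 ->
  #|[set p : {perm 'I_n} | ballot p && (des p == d)]| =
  #|[set p : {perm 'I_n} | odd_order p && (Mstat p == d)]|.
Proof.
(* Both cardinals become coefficients of ['X^d] in integer polynomials, which [balseq_oddseq]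
   identifies. *)
move=> _ _; apply/eqP; rewrite -(eqr_nat int) -!coef_sum_stat.
by rewrite sum_ballot_perm sum_odd_perm balseq_oddseq.
Qed.
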